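(* Let $n\in2\mathbb{Z}_{\ge0}$. For $p(t),q(t)\in\mathrm{Pol}_n[t]$ write $p(t)\stackrel{k_0}{\sim}q(t)$ if $\pi_n(k_0)p(t)\in\mathbb{C}q(t)$. Then the following hold. (1) If $n\equiv0\pmod4$: (a) $a_{[s;n]}(t)\stackrel{k_0}{\sim}u_{[s;n]}(t)$ for $s\in\mathbb{C}\setminus(I_0^-\cup J_0)$; (b) $b_{[s;n]}(t)\stackrel{k_0}{\sim}u_{[s;n]}(t)$ for $s\in J_0$; (c) $c^+_{[s;n]}(t)\stackrel{k_0}{\sim}u_{[s;n]}(t)$ for $s\in I_0^-$; (d) $b_{[s;n]}(t)\stackrel{k_0}{\sim}v_{[s;n]}(t)$ for $s\in I_0^+$; (e) $c^-_{[s;n]}(t)\stackrel{k_0}{\sim}v_{[s;n]}(t)$ for $s\in I_0^-$. (2) If $n\equiv2\pmod4$: (a) $a_{[s;n]}(t)\stackrel{k_0}{\sim}v_{[s;n]}(t)$ for $s\in\mathbb{C}\setminus(I_2^-\cup J_2)$; (b) $b_{[s;n]}(t)\stackrel{k_0}{\sim}v_{[s;n]}(t)$ for $s\in J_2$; (c) $c^+_{[s;n]}(t)\stackrel{k_0}{\sim}v_{[s;n]}(t)$ for $s\in I_2^-$; (d) $b_{[s;n]}(t)\stackrel{k_0}{\sim}u_{[s;n]}(t)$ for $s\in I_2^+$; (e) $c^-_{[s;n]}(t)\stackrel{k_0}{\sim}u_{[s;n]}(t)$ for $s\in I_2^-$.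
   Context: $\mathrm{Pol}_n[t]$ is the space of complex polynomials in $t$ of degree at most $n$, on which $SU(2)$ acts by $(\pi_n(g)p)(t)=(ct+d)^np\left(\frac{at+b}{ct+d}\right)$ for $g=\begin{pmatrix}a&b\\c&d\end{pmatrix}^{-1}$. Put $k_0=\frac1{\sqrt2}\begin{pmatrix}\sqrt{-1}&1\\-1&-\sqrt{-1}\end{pmatrix}\in SU(2)$. Sets (depending on $n$; $[\cdot]$ is the integer part): for $n\in4\mathbb{Z}_{\ge0}$, $I_0^\pm=\{\pm(3+4j):0\le j\le\frac n4-1\}$ and $J_0=\{1+4j:0\le j\le\frac n4-1\}$; and $I_2^\pm=\{\pm(1+4j):0\le j\le[\frac n4]\}$, $J_2=\{3+4j:0\le j\le[\frac n4]-1\}$. Hypergeometric side: with $F(a,b,c;z)={}_2F_1(a,b;c;z)$, $$a_{[s;n]}(t)=F\left(-\tfrac n2,-\tfrac{n+s-1}{4},\tfrac{3-n+s}{4};t^2\right),\qquad b_{[s;n]}(t)=t^{\frac{1+n-s}{2}}F\left(-\tfrac{n+s-1}{4},-\tfrac{s-1}{2},\tfrac{5+n-s}{4};t^2\right).$$ If the third parameter $c$ is a non-positive integer and one of the first two parameters is a non-positive integer $-N\ge c$ (with $N$ minimal among such), $F(a,b,c;z)$ is understood as the truncated sum $\sum_{j=0}^{N}\frac{(a,j)(b,j)}{(c,j)\,j!}z^j$, where $(\ell,m)=\ell(\ell+1)\cdots(\ell+m-1)$ is the shifted factorial; in particular $a_{[-1;4\ell+2]}(t)=\sum_{j=0}^{\ell}\frac{(-2\ell-1,j)}{j!}t^{2j}$.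 For $n\equiv k\pmod4$ with $k\in\{0,2\}$ and $s\in I_k^-$, $c^\pm_{[s;n]}(t)=a_{[s;n]}(t)\pm C(s;n)b_{[s;n]}(t)$, where $C(s;n)=\frac{(-\frac n2,[\frac n4])}{[\frac n4]!}$ if $n\equiv2\pmod4$ and $s=-1$, and otherwise $$C(s;n)=\frac{\left(-\frac n2,\frac{n+s-1}{4}\right)\left(-\frac{n+s-1}{4},\frac{n+s-1}{4}\right)}{\left(\frac{3-n+s}{4},\frac{n+s-1}{4}\right)}\cdot\frac{1}{\left(\frac{n+s-1}{4}\right)!}.$$ Heun side: $Hl(a,q;\alpha,\beta,\gamma,\delta;z)$ denotes the local Heun function, i.e. the power series solution at $z=0$ with constant term $1$ of Heun's equation $$f''(z)+\left(\frac\gamma z+\frac\delta{z-1}+\frac{\varepsilon}{z-a}\right)f'(z)+\frac{\alpha\beta z-q}{z(z-1)(z-a)}f(z)=0,\qquad \gamma+\delta+\varepsilon=\alpha+\beta+1,$$ and $$u_{[s;n]}(t)=Hl\left(-1,-\tfrac{ns}4;-\tfrac n2,-\tfrac{n-1}2,\tfrac12,\tfrac{1-n-s}2;t^2\right),$$ $$v_{[s;n]}(t)=t\,Hl\left(-1,-\tfrac{(n-2)s}4;-\tfrac{n-1}2,-\tfrac{n-2}2,\tfrac32,\tfrac{1-n-s}2;t^2\right).$$ *)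

(* Defs.v *)
From HB Require Import structures.
From mathcomp Require Import all_boot all_order all_algebra.
From mathcomp Require Import complex ring.
From mathcomp Require Import boolp classical_sets reals.

Set Implicit Arguments.
Unset Strict Implicit.
Unset Printing Implicit Defensive.

Import Order.TTheory GRing.Theory Num.Theory.
Local Open Scope ring_scope.
Local Open Scope complex_scope.
Local Open Scope complex_scope.

Section Representation.
Variable R : realType.
Local Notation C := R[i].

Definition mx2 (a b c d : C) : 'M[C]_2 :=
  \matrix_(i < 2, j < 2)
    if i == 0 then (if j == 0 then a else b) else (if j == 0 then c else d).

Definition k0 : 'M[C]_2 :=
  ((Num.sqrt 2)^-1)%:C *: mx2 'i%C 1 (- 1) (- 'i%C).

(* (ct + d)^n p((at + b)/(ct + d)) with the denominators cleared, where
   (a b; c d) is the inverse of g; see [pi_repE]. *)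
Definition pi_rep (n : nat) (g : 'M[C]_2) (p : {poly C}) : {poly C} :=
  let h := invmx g in
  \sum_(i < n.+1) p`_i *: ((h 0 0 *: 'X + (h 0 1)%:P) ^+ i *
                           (h 1 0 *: 'X + (h 1 1)%:P) ^+ (n - i)).

Lemma pi_repE n (a b c d : C) (p : {poly C}) t :
  (size p <= n.+1)%N -> c * t + d != 0 ->
  (pi_rep n (invmx (mx2 a b c d)) p).[t] =
  (c * t + d) ^+ n * p.[(a * t + b) / (c * t + d)].
Proof.
move=> sp cd0; rewrite /pi_rep invmxK !mxE /=.
rewrite horner_sum (horner_coef_wide _ sp) mulr_sumr.
apply: eq_bigr => i _.
rewrite hornerZ hornerM !horner_exp !hornerD !hornerZ !hornerX !hornerC.
have le_in : (i <= n)%N by rewrite -ltnS.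
rewrite expr_div_n.
have -> : (c * t + d) ^+ n = (c * t + d) ^+ (n - i) * (c * t + d) ^+ i.
  by rewrite -exprD subnK.
by have := expf_neq0 i cd0; move: (_ ^+ i) => u u0; field.
Qed.

Lemma k0_SU2 :
  \det k0 = 1 /\ k0 *m (map_mx (@conjc R) k0)^T = 1%:M.
Proof.
have h2 : (((Num.sqrt 2)^-1)%:C * ((Num.sqrt 2)^-1)%:C)%R = 2^-1 :> C.
  rewrite -rmorphM /= -invfM -expr2 sqr_sqrtr ?ler0n //.
  by rewrite fmorphV /= rmorph_nat.
have ii : 'i%C * 'i%C = -1 :> C by rewrite -expr2 sqr_i.
have n2 : (2 : C) != 0 by rewrite pnatr_eq0.
have cr (x : R) : conjc x%:C = x%:C by apply/eqP; rewrite eq_complex /= oppr0 !eqxx.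
have ci : conjc ('i%C : C) = - 'i%C by apply/eqP; rewrite eq_complex /= oppr0 !eqxx.
have cM (x y : C) : conjc (x * y) = conjc x * conjc y by rewrite rmorphM.
have cN (x : C) : conjc (- x) = - conjc x by rewrite rmorphN.
have c1 : conjc (1 : C) = 1 by rewrite rmorph1.
split.
  rewrite (expand_det_row _ 0) !big_ord_recl big_ord0 /cofactor !det_mx11 !mxE /=.
  move: h2 ii; set r := (_%:C); set I := 'i%C => h2 ii.
  have -> : r * I * ((-1) ^+ (0 + 0) * (r * - I)) +
     (r * 1 * ((-1) ^+ (0 + bump 0 0) * (r * -1)) + 0) = (r * r) * (1 - I * I).
    by rewrite /bump /=; ring.
  by rewrite h2 ii; field.
apply/matrixP => i j; rewrite !mxE !big_ord_recl big_ord0 !mxE !cM cr.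
rewrite !(fun_if (@conjc R)) !cN c1 ci opprK.
move: h2 ii; set r := (_%:C); set I := 'i%C => h2 ii.
have e1 : (r * r) * (1 - I * I) = 1 by rewrite h2 ii; field.
case: i => [[|[|//]] ?]; case: j => [[|[|//]] ?] /=;
  [apply: etrans _ e1 | | | apply: etrans _ e1]; ring.
Qed.

End Representation.

(* Formal power series over C are sequences of coefficients. *)
Section PowerSeries.
Variable R : realType.
Local Notation C := R[i].
Implicit Types f g : nat -> C.

(* f(t^2) *)
Definition ps_sq f : nat -> C := fun k => if odd k then 0 else f k./2.

(* t^e f(t) *)
Definition ps_shift (e : nat) f : nat -> C :=
  fun k => if (k < e)%N then 0 else f (k - e)%N.

Definition ps_deriv f : nat -> C := fun k => k.+1%:R * f k.+1.

(* P(t) f(t), a Cauchy product *)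
Definition ps_mul (P : {poly C}) f : nat -> C :=
  fun k => \sum_(i < k.+1) P`_i * f (k - i)%N.

Definition poly_of_ps (p : {poly C}) f : Prop := forall i, p`_i = f i.

(* f ~ g for power series f and g: both lie in Pol_n[t], and
   pi_n(k_0) f is in C g. *)
Definition sim_k0 (n : nat) f g : Prop :=
  exists p q : {poly C},
    [/\ (size p <= n.+1)%N, (size q <= n.+1)%N,
        poly_of_ps p f, poly_of_ps q g &
        exists lambda : C, pi_rep n (k0 R) p = lambda *: q].

(* The value of z when z is a natural number, the only case in which it is
   used below. *)
Definition natpart (z : C) : nat := Num.truncn (complex.Re z).

Lemma natpart_nat (k : nat) : natpart k%:R = k.
Proof.
rewrite /natpart -(rmorph_nat (real_complex R)) /=.
exact: natrK.
Qed.

End PowerSeries.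

Section Hypergeometric.
Variable R : realType.
Local Notation C := R[i].

Definition sfact (l : C) (m : nat) : C := \prod_(i < m) (l + i%:R).

(* Since x / 0 = 0, all terms of index > M vanish when c = - M; hence the
   series is the truncated sum as soon as a or b is - N with N <= M:
   see [hypF_trunc]. *)
Definition hypF (a b c : C) : nat -> C :=
  fun j => sfact a j * sfact b j / (sfact c j * j`!%:R).

Lemma sfact_eq0 (N m : nat) : (N < m)%N -> sfact (- N%:R) m = 0.
Proof.
by move=> lt; rewrite /sfact (bigD1 (Ordinal lt)) //= addNr mul0r.
Qed.

Lemma sfact_neq0 (M m : nat) : (m <= M)%N -> sfact (- M%:R) m != 0.
Proof.
move=> le; apply/prodf_neq0 => i _; rewrite addrC subr_eq0 eqr_nat.
by rewrite neq_ltn (leq_trans (ltn_ord i) le).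
Qed.

Lemma hypF_trunc (a b c : C) (N M : nat) :
  a = - N%:R \/ b = - N%:R -> c = - M%:R -> (N <= M)%N ->
  (forall j, (j <= N)%N -> sfact c j != 0) /\
  forall j, hypF a b c j =
    if (j <= N)%N then sfact a j * sfact b j / (sfact c j * j`!%:R) else 0.
Proof.
move=> ab -> NM; split=> j.
  by move=> jN; apply: sfact_neq0; apply: leq_trans jN NM.
rewrite /hypF; case: leqP => // Nj.
by case: ab => ->; rewrite (sfact_eq0 Nj) ?(mul0r, mulr0).
Qed.

Implicit Types (n : nat) (s : C).

Definition aS n s : nat -> C :=
  ps_sq (hypF (- (n%:R / 2)) (- ((n%:R + s - 1) / 4)) ((3 - n%:R + s) / 4)).

(* Meaningful when (1 + n - s) / 2 is a natural number. *)
Definition bS n s : nat -> C :=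
  ps_shift (natpart ((1 + n%:R - s) / 2))
    (ps_sq (hypF (- ((n%:R + s - 1) / 4)) (- ((s - 1) / 2))
                 ((5 + n%:R - s) / 4))).

(* Meaningful when (n + s - 1) / 4 is a natural number. *)
Definition Ccst n s : C :=
  if ((n %% 4 == 2)%N && (s == - 1)) then
    sfact (- (n%:R / 2)) (n %/ 4) / (n %/ 4)`!%:R
  else
    let z := (n%:R + s - 1) / 4 in
    let m := natpart z in
    sfact (- (n%:R / 2)) m * sfact (- z) m / sfact ((3 - n%:R + s) / 4) m
    * (1 / m`!%:R).

Definition cplusS n s : nat -> C := fun k => aS n s k + Ccst n s * bS n s k.
Definition cminusS n s : nat -> C := fun k => aS n s k - Ccst n s * bS n s k.

Definition I0plus n s : Prop :=
  exists2 j, (j < n %/ 4)%N & s = (3 + 4 * j)%:R.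
Definition I0minus n s : Prop :=
  exists2 j, (j < n %/ 4)%N & s = - (3 + 4 * j)%:R.
Definition J0 n s : Prop :=
  exists2 j, (j < n %/ 4)%N & s = (1 + 4 * j)%:R.
Definition I2plus n s : Prop :=
  exists2 j, (j <= n %/ 4)%N & s = (1 + 4 * j)%:R.
Definition I2minus n s : Prop :=
  exists2 j, (j <= n %/ 4)%N & s = - (1 + 4 * j)%:R.
Definition J2 n s : Prop :=
  exists2 j, (j < n %/ 4)%N & s = (3 + 4 * j)%:R.

End Hypergeometric.

Section Heun.
Variable R : realType.
Local Notation C := R[i].
Implicit Types f g : nat -> C.

(* Heun's equation multiplied by z (z - 1) (z - a). *)
Definition heun_equation (a q alpha beta gamma delta : C) f : Prop :=
  let epsilon := alpha + beta + 1 - gamma - delta in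
  forall k,
    ps_mul ('X * ('X - 1) * ('X - a%:P)) (ps_deriv (ps_deriv f)) k
  + ps_mul (gamma *: (('X - 1) * ('X - a%:P)) + delta *: ('X * ('X - a%:P))
            + epsilon *: ('X * ('X - 1))) (ps_deriv f) k
  + ps_mul ((alpha * beta) *: 'X - q%:P) f k = 0.

Definition is_local_heun (a q alpha beta gamma delta : C) f : Prop :=
  f 0%N = 1 /\ heun_equation a q alpha beta gamma delta f.

(* The local Heun function; [HlP] shows that it is well defined. *)
Definition Hl (a q alpha beta gamma delta : C) : nat -> C :=
  xget (fun=> 0) [set f | is_local_heun a q alpha beta gamma delta f].

Definition uS (n : nat) (s : C) : nat -> C :=
  ps_sq (Hl (- 1) (- (n%:R * s / 4)) (- (n%:R / 2)) (- ((n%:R - 1) / 2))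
            (1 / 2) ((1 - n%:R - s) / 2)).

Definition vS (n : nat) (s : C) : nat -> C :=
  ps_shift 1
    (ps_sq (Hl (- 1) (- ((n%:R - 2) * s / 4)) (- ((n%:R - 1) / 2))
               (- ((n%:R - 2) / 2)) (3 / 2) ((1 - n%:R - s) / 2))).

Lemma ps_mulD P Q f k : ps_mul (P + Q) f k = ps_mul P f k + ps_mul Q f k.
Proof.
by rewrite /ps_mul -big_split /=; apply: eq_bigr => i _; rewrite coefD mulrDl.
Qed.

Lemma ps_mulC c f k : ps_mul c%:P f k = c * f k.
Proof.
rewrite /ps_mul big_ord_recl big1 ?addr0 => [|i _]; first by rewrite coefC subn0.
by rewrite coefC mul0r.
Qed.

Lemma ps_mulX P f k :
  ps_mul (P * 'X) f k = if k is k'.+1 then ps_mul P f k' else 0.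
Proof.
rewrite /ps_mul; case: k => [|k].
  by rewrite big_ord_recl big_ord0 coefMX /= mul0r addr0.
rewrite big_ord_recl coefMX mul0r add0r.
by apply: eq_bigr => i _; rewrite coefMX.
Qed.

Definition heun_rec (a q alpha beta gamma delta : C) f : Prop :=
  let epsilon := alpha + beta + 1 - gamma - delta in
  forall k, a * k.+1%:R * (k%:R + gamma) * f k.+1 =
    (k%:R * ((k%:R - 1 + gamma) * (1 + a) + a * delta + epsilon) + q) * f k
    - (if k is k'.+1 then (k'%:R + alpha) * (k'%:R + beta) * f k' else 0).

Lemma heun_equationE a q alpha beta gamma delta f :
  heun_equation a q alpha beta gamma delta f <->
  heun_rec a q alpha beta gamma delta f.
Proof.
rewrite /heun_equation /heun_rec; set e := (_ - delta).
have e2 : 'X * ('X - 1) * ('X - a%:P) =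
  (((1%:P * 'X + (- (1 + a))%:P) * 'X + a%:P) * 'X + 0%:P) :> {poly C}.
  by rewrite polyCN polyCD !polyC1 polyC0; ring.
have e1 : gamma *: (('X - 1) * ('X - a%:P)) + delta *: ('X * ('X - a%:P))
            + e *: ('X * ('X - 1)) =
  (((gamma + delta + e)%:P * 'X + (- (gamma * (1 + a) + delta * a + e))%:P) * 'X
   + (gamma * a)%:P) :> {poly C}.
  rewrite -!mul_polyC !(polyCN, polyCD, polyCM) !polyC1; ring.
have e0 : (alpha * beta) *: 'X - q%:P = (alpha * beta)%:P * 'X + (- q)%:P
  :> {poly C}.
  by rewrite -mul_polyC polyCN.
have key k :
    ps_mul ('X * ('X - 1) * ('X - a%:P)) (ps_deriv (ps_deriv f)) k
  + ps_mul (gamma *: (('X - 1) * ('X - a%:P)) + delta *: ('X * ('X - a%:P))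
            + e *: ('X * ('X - 1))) (ps_deriv f) k
  + ps_mul ((alpha * beta) *: 'X - q%:P) f k =
   a * k.+1%:R * (k%:R + gamma) * f k.+1 -
   ((k%:R * ((k%:R - 1 + gamma) * (1 + a) + a * delta + e) + q) * f k
    - (if k is k'.+1 then (k'%:R + alpha) * (k'%:R + beta) * f k' else 0)).
  rewrite e2 e1 e0 !(ps_mulD, ps_mulX, ps_mulC) /ps_deriv /e.
  case: k => [|[|[|k]]]; rewrite ?(ps_mulD, ps_mulX, ps_mulC) -?natr1; try ring.
by split=> H k; apply/eqP; move/eqP: (H k); rewrite key subr_eq0.
Qed.

Fixpoint heun_pair (a q alpha beta gamma delta : C) (k : nat) : C * C :=
  if k is k'.+1 then
    let: (x, y) := heun_pair a q alpha beta gamma delta k' in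
    let epsilon := alpha + beta + 1 - gamma - delta in
    (y, ((k'.+1%:R * ((k'.+1%:R - 1 + gamma) * (1 + a) + a * delta + epsilon) + q)
         * y - (k'%:R + alpha) * (k'%:R + beta) * x)
        / (a * k'.+2%:R * (k'.+1%:R + gamma)))
  else (1, q / (a * gamma)).

Lemma HlP a q alpha beta gamma delta :
  a != 0 -> (forall k : nat, gamma != - k%:R) ->
  is_local_heun a q alpha beta gamma delta (Hl a q alpha beta gamma delta) /\
  forall f, is_local_heun a q alpha beta gamma delta f ->
            f = Hl a q alpha beta gamma delta.
Proof.
move=> a0 g0.
have d0 k : a * k.+1%:R * (k%:R + gamma) != 0.
  by rewrite !mulf_neq0 ?pnatr_eq0 // addrC -(opprK k%:R) subr_eq0.
have uniq_f f g : is_local_heun a q alpha beta gamma delta f ->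
    is_local_heun a q alpha beta gamma delta g -> f = g.
  move=> [f0 /heun_equationE Hf] [g0' /heun_equationE Hg].
  suff H k : f k = g k /\ f k.+1 = g k.+1 by apply/funext => k; case: (H k).
  elim: k => [|k [IH1 IH2]].
    split; first by rewrite f0 g0'.
    by apply: (mulfI (d0 0%N)); rewrite Hf Hg f0 g0'.
  by split=> //; apply: (mulfI (d0 k.+1)); rewrite Hf Hg IH1 IH2.
have ex : is_local_heun a q alpha beta gamma delta
    (fun k => (heun_pair a q alpha beta gamma delta k).1).
  split=> //; apply/heun_equationE => e [|k] /=.
    have := d0 0%N; rewrite mulr1 add0r => d.
    by rewrite mul0r add0r subr0 mulr1 mulrC divfK.
  have := d0 k.+1; case: (heun_pair _ _ _ _ _ _ k) => x y /= d.
  by rewrite [LHS]mulrC divfK.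
have HH : is_local_heun a q alpha beta gamma delta (Hl a q alpha beta gamma delta).
  by rewrite /Hl; apply: (@xgetI _ _
    [set f | is_local_heun a q alpha beta gamma delta f] _ ex).
by split=> // f Hf; apply: uniq_f.
Qed.

End Heun.

(* Main.v *)
Require Import Defs.
From HB Require Import structures.
From mathcomp Require Import all_boot all_order all_algebra.
From mathcomp Require Import complex boolp classical_sets reals.
From mathcomp Require Import ring zify.

(** Write E, F, H for the standard basis of sl2 acting on polynomials of degree
    at most n, with E = d/dt. In the variable t, both Heun equations express
    (E^2 - F^2 - s H) q = 0, one for even and one for odd q, and the
    hypergeometric equations of a and b both express
    ((H (E + F) + (E + F) H) / 2 - s (E - F)) p = 0. The action of k0 carries
    the second operator to the first one, up to a scalar ([heun_op_cayley]). So
    it maps polynomial solutions p to polynomial solutions q, and it is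
    injective ([cayley_free]). As the recursion for the coefficients of q steps
    by 2 and determines everything from the lowest coefficient, a nonzero
    polynomial solution q that is even or odd is a multiple of u or v
    ([heun_kernel]).

    It remains to decide the parity of q. Under k0 the substitution t |-> - t
    corresponds to the reversal p_j |-> p_(n - j) of the coefficients with
    explicit signs ([cayley_reflect]), so the parity of q is read off from the
    parity of p, the class of n modulo 4, and whether p is palindromic or
    antipalindromic ([sim_k0_heunS]).

    The two-term recursion for p is invariant under reversal. Where it can be
    solved from the middle index outwards, this forces p to be palindromic
    ([two_term_palindromic]); this settles a and those b that contain the middle
    index. Exceptional values are s = n + 1 - 2 r with 0 < r <= n. There the
    recursion breaks at r and at n - r: b is the solution starting at r. If r is
    even and r > n / 2, the solution a ends at n - r, before b starts, and the
    constant C is the last coefficient of a, so that C b is the reversal of a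
    ([bS_reflects_aS]). Then a + C b is palindromic and a - C b is
    antipalindromic. *)

Import Order.TTheory GRing.Theory Num.Theory.
Local Open Scope ring_scope.
Local Open Scope complex_scope.

(** * The action of k0 on monomials *)

Section Cayley.
Set Implicit Arguments.
Unset Strict Implicit.
Variable R : realType.
Local Notation C := R[i].
Implicit Types (n k : nat) (s : C) (p q : {poly C}) (f : nat -> C).
Local Notation zeta := ('X - ('i%C : C)%:P : {poly C}).
Local Notation omega := ('X + ('i%C : C)%:P : {poly C}).

(** The images under [pi_rep n (k0 R)] of the monomials, up to a common scalar:
    the Moebius map of k0 is t |-> - i (t - i) / (t + i). *)
Definition cayley n k : {poly C} :=
  (- 'i%C : C) ^+ k *: (zeta ^+ k * omega ^+ (n - k)).

Lemma pi_rep_k0 n p :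
  pi_rep n (k0 R) p =
  (((Num.sqrt 2)^-1)%:C) ^+ n *: \sum_(k < n.+1) p`_k *: cayley n k.
Proof.
have ii : 'i%C * 'i%C = -1 :> C by rewrite -expr2 sqr_i.
have h2 : (((Num.sqrt 2)^-1)%:C * ((Num.sqrt 2)^-1)%:C)%R * 2 = 1 :> C.
  rewrite -rmorphM /= -invfM -expr2 sqr_sqrtr ?ler0n //.
  by rewrite fmorphV /= rmorph_nat mulVf // pnatr_eq0.
pose h : 'M[C]_2 := (((Num.sqrt 2)^-1)%:C) *: mx2 (- 'i%C) (- 1) 1 'i%C.
have hk : h *m k0 R = 1%:M.
  apply/matrixP => i j; rewrite !mxE !big_ord_recl big_ord0 !mxE.
  move: h2 ii; set r := (_%:C); set I := 'i%C => h2 ii.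
  by case: i => [[|[|//]] ?]; case: j => [[|[|//]] ?] /=; ring: h2 ii.
have invE : invmx (k0 R) = h.
  have [_ ku] := mulmx1_unit hk.
  by rewrite -[LHS]mul1mx -hk -mulmxA mulmxV // mulmx1.
rewrite /pi_rep invE scaler_sumr; apply: eq_bigr => -[k /= lt_kn] _.
rewrite !mxE /= [RHS]scalerA [X in X *: cayley _ _]mulrC -[RHS]scalerA.
congr (_ *: _); rewrite /cayley.
set r := (_%:C); set I : C := 'i%C.
have -> : (r * - I) *: 'X + (r * -1)%:P = (r * - I) *: zeta.
  by rewrite -!mul_polyC !(polyCM, polyCN); ring: (congr1 polyC ii).
have -> : (r * 1) *: 'X + (r * I)%:P = r *: omega.
  by rewrite -!mul_polyC !(polyCM, polyCN); ring.
rewrite !exprZn -scalerAl -scalerAr !scalerA exprMn; congr (_ *: _).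
by rewrite mulrAC -exprD subnKC.
Qed.

Lemma size_cayley n k : (k <= n)%N -> (size (cayley n k) <= n.+1)%N.
Proof.
move=> le_kn; apply: leq_trans (size_scale_leq _ _) _.
rewrite -polyCN; apply: leq_trans (size_polyMleq _ _) _.
rewrite polyCN size_exp_XsubC -[X in X%:P]opprK polyCN size_exp_XsubC; lia.
Qed.

Lemma size_pi_rep_k0 n p : (size (pi_rep n (k0 R) p) <= n.+1)%N.
Proof.
rewrite pi_rep_k0; apply: leq_trans (size_scale_leq _ _) _.
apply: leq_trans (size_sum _ _ _) _; apply/bigmax_leqP => k _.
apply: leq_trans (size_scale_leq _ _) _; apply: size_cayley.
by rewrite -ltnS.
Qed.

(** Evaluating at the root i of zeta isolates the coefficient of index 0; after
    division by zeta the degree has dropped by one. *)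
Lemma cayley_free n (c : nat -> C) :
  \sum_(k < n.+1) c k *: cayley n k = 0 -> forall k, (k <= n)%N -> c k = 0.
Proof.
have i0 : 'i%C != 0 :> C by rewrite neq0Ci.
elim: n c => [|n IH] c.
  rewrite big_ord_recl big_ord0 addr0 /cayley subnn !expr0 mul1r scale1r => H.
  case=> // _; move/(congr1 (fun p => p`_0)): H.
  by rewrite coefZ coef1 coef0 mulr1.
rewrite big_ord_recl => H.
pose S := \sum_(k < n.+1) (c k.+1 * - 'i%C) *: cayley n k.
have HS : \sum_(k < n.+1) c (lift ord0 k) *: cayley n.+1 (lift ord0 k)
          = zeta * S.
  rewrite mulr_sumr; apply: eq_bigr => k _.
  rewrite /cayley lift0 subSS !exprS -!mul_polyC !(polyCM); ring.
have c0 : c 0%N = 0.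
  move/(congr1 (fun p => p.['i%C])): H.
  rewrite HS hornerD hornerM hornerXsubC subrr mul0r addr0 horner0.
  rewrite /cayley expr0 scale1r mul1r subn0 hornerZ horner_exp hornerD hornerX.
  rewrite hornerC => /eqP; rewrite mulf_eq0 expf_eq0 /= -mulr2n mulrn_eq0.
  by rewrite (negPf i0) !orbF => /eqP.
have S0 : S = 0.
  move: H; rewrite HS c0 scale0r add0r => /eqP.
  by rewrite mulf_eq0 polyXsubC_eq0 /= => /eqP.
case=> // k; rewrite ltnS => le_kn.
have /eqP := IH (fun k => c k.+1 * - 'i%C) S0 k le_kn.
by rewrite mulf_eq0 oppr_eq0 (negPf i0) orbF => /eqP.
Qed.

(** The involution t |-> - t exchanges zeta and omega up to sign. Hence on the
    other side of the Cayley transform it is the reversal of coefficients, up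
    to the sign computed here, and this sign decides between even and odd. *)
Lemma cayley_reflect n k : (k <= n)%N -> ~~ odd n ->
  cayley n k \Po (- 'X) = (-1) ^+ (k + n./2) *: cayley n (n - k).
Proof.
move=> le_kn ev.
rewrite /cayley comp_polyZ comp_polyM !rmorphXn /= comp_polyB comp_polyD.
rewrite comp_polyX !comp_polyC scalerA subKn //.
have -> : - 'X - ('i%C : C)%:P = -1 *: omega by rewrite scaleN1r; ring.
have -> : - 'X + ('i%C : C)%:P = -1 *: zeta by rewrite scaleN1r; ring.
rewrite !exprZn -scalerAl -scalerAr !scalerA [omega ^+ _ * _]mulrC.
congr (_ *: _).
have i2 : (- 'i%C) ^+ 2 = -1 :> C by rewrite sqrrN sqr_i.
have i0 : (- 'i%C) ^+ k != 0 :> C by rewrite expf_neq0 // oppr_eq0 neq0Ci.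
have H1 : (- 'i%C) ^+ k * (- 'i%C) ^+ k = (-1) ^+ k :> C.
  by rewrite -expr2 -exprM mulnC exprM i2.
have H2 : (- 'i%C) ^+ (n - k) * (- 'i%C) ^+ k = (-1) ^+ n./2 :> C.
  by rewrite -exprD subnK // -[X in _ ^+ X](even_halfK ev) -mul2n exprM i2.
apply: (mulIf i0); rewrite -[RHS]mulrA H2.
rewrite mulrAC [X in X * _]mulrAC H1 -!exprD.
by rewrite -signr_odd -[RHS]signr_odd; congr (_ ^+ _); lia.
Qed.

(** * The intertwined differential operators *)

(** This is E^2 - F^2 - s H for the sl2-action E = d/dt, F = n t - t^2 d/dt and
    H = n - 2 t d/dt on polynomials of degree at most n. *)
Definition heun_op n s q : {poly C} :=
  q^`()^`() - q^`()^`() * 'X^4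
  + (2 * n%:R - 2) *: (q^`() * 'X^3) + (2 * s) *: (q^`() * 'X)
  - (n%:R * (n%:R - 1)) *: (q * 'X^2) - (s * n%:R) *: q.

Lemma heun_op_linear n s a p q :
  heun_op n s (a *: p + q) = a *: heun_op n s p + heun_op n s q.
Proof.
rewrite /heun_op !(derivD, derivZ) -!mul_polyC !(polyCM, polyCB); ring.
Qed.

Lemma heun_op_sum n s m (c : nat -> C) (e : nat -> {poly C}) :
  heun_op n s (\sum_(k < m) c k *: e k) = \sum_(k < m) c k *: heun_op n s (e k).
Proof.
elim: m => [|m IH].
  by rewrite !big_ord0 /heun_op !deriv0 !mul0r !scaler0 !(subr0, addr0).
by rewrite !big_ord_recr /= addrC heun_op_linear IH addrC.
Qed.

(** In the Cayley basis, E^2 - F^2 - s H becomes i times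
    (H (E + F) + (E + F) H) / 2 - s (E - F), which only links neighbours.
    The identity is checked after multiplication by (zeta omega)^2, where the
    derivatives of the basis vector and its two neighbours all become multiples
    of the basis vector itself. *)
Lemma heun_op_cayley n s k : (k <= n)%N ->
  heun_op n s (cayley n k) =
  'i%C *: (((n%:R - k%:R) * (s - 1 + n%:R - 2 * k%:R)) *: cayley n k.+1
           - (k%:R * (s - 1 - n%:R + 2 * k%:R)) *: cayley n k.-1).
Proof.
move=> le_kn.
have ii : 'i%C * 'i%C = -1 :> C by rewrite -expr2 sqr_i.
have iiP : ('i%C)%:P * ('i%C)%:P = -1 :> {poly C} by rewrite -polyCM ii polyCN.
have z0 : zeta != 0 by rewrite polyXsubC_eq0.
have o0 : omega != 0 by rewrite -[X in X%:P]opprK polyCN polyXsubC_eq0.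
have dz : zeta^`() = 1 by rewrite derivB derivX derivC subr0.
have dw : omega^`() = 1 by rewrite derivD derivX derivC addr0.
have dpow (a : {poly C}) m : a^`() = 1 -> a * (a ^+ m)^`() = m%:R%:P * a ^+ m.
  move=> a1; rewrite deriv_exp a1 mul1r -mulr_natl -polyC_natr.
  by case: m => [|m]; rewrite ?polyC0 ?mul0r ?mulr0 //= exprS; ring.
pose a : C := k%:R; pose b : C := n%:R - k%:R.
have bE : (n - k)%:R = b by rewrite natrB.
set e := cayley n k.
pose L := a%:P * omega + b%:P * zeta.
(* The logarithmic derivative of e is L / (zeta omega). *)
have d1 : zeta * omega * e^`() = L * e.
  have hz := dpow zeta k dz; have hw := dpow omega (n - k)%N dw.
  rewrite /e /cayley derivZ derivM -!mul_polyC /L.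
  transitivity (((- 'i) ^+ k)%:P * (omega * omega ^+ (n - k) *
      (zeta * (zeta ^+ k)^`()) + zeta * zeta ^+ k *
      (omega * (omega ^+ (n - k))^`()))); first by ring.
  by rewrite hz hw bE /a; ring.
have d2 : (zeta * omega) ^+ 2 * e^`()^`() =
          ((a + b)%:P * (zeta * omega) + (L - zeta - omega) * L) * e.
  have dL : L^`() = (a + b)%:P.
    by rewrite /L derivD !derivM !derivC dz dw !mul0r !add0r !mulr1 -polyCD.
  have := congr1 deriv d1; rewrite !derivM dz dw dL => d2.
  have {}d2 : zeta * omega * e^`()^`()
            = (a + b)%:P * e + (L - zeta - omega) * e^`().
    apply: (addIr ((zeta + omega) * e^`())); apply: etrans (etrans d2 _).
      by ring.
    by rewrite polyCD /L; ring.
  rewrite expr2 -mulrA d2 mulrDr mulrCA mulrA -/(zeta * omega).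
  rewrite (_ : zeta * omega * ((L - zeta - omega) * e^`()) =
               (L - zeta - omega) * (L * e)); last by rewrite -d1; ring.
  ring.
(* When k = n the neighbour k + 1 does not exist, but then b = 0; the factor a
   takes care of k = 0 in the same way. *)
have up : omega * (b%:P * cayley n k.+1) = b%:P * (- 'i%C)%:P * zeta * e.
  have [kn|lt_kn] : k = n \/ (k < n)%N by lia.
    by rewrite /b kn subrr polyC0 !mul0r mulr0.
  rewrite /e /cayley (_ : n - k = (n - k.+1).+1)%N; last by lia.
  by rewrite -!mul_polyC !exprS polyCM; ring.
have down : zeta * (a%:P * (- 'i%C)%:P * cayley n k.-1) = a%:P * omega * e.
  rewrite /e /a; case: (k) le_kn => [|k'] le_kn; first by rewrite polyC0 !mul0r mulr0.
  rewrite /cayley /= (_ : n - k' = (n - k'.+1).+1)%N; last by lia.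
  by rewrite -!mul_polyC !exprS polyCM; ring.
apply: (mulfI (expf_neq0 2 (mulf_neq0 z0 o0))).
have nE : n%:R = a + b :> C by rewrite /a /b; ring.
rewrite /heun_op -/a nE.
have -> : a + b - a = b by ring.
rewrite /L in d1 d2 *; move: (e^`()^`()) d2 => e2 d2; move: (e^`()) d1 => e1 d1.
move: e (cayley n k.+1) (cayley n k.-1) a b d1 d2 up down {L bE nE}.
move=> e u v a b d1 d2 up down.
rewrite -!mul_polyC !(polyCM, polyCB, polyCD, polyC1, polyCN, polyC_natr)
  in d2 up down *.
move: (a%:P) (b%:P) (s%:P) ('i%C)%:P iiP d1 d2 up down.
move=> {z0 o0 dz dw}a {}b {}s I iiP d1 d2 up down.
transitivity ((1 - 'X^4) * (((('X - I) * ('X + I)) ^+ 2) * e2) +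
  (('X - I) * ('X + I)) * ((2 * (a + b) - 2) * 'X^3 + 2 * s * 'X) *
  ((('X - I) * ('X + I)) * e1) - (('X - I) * ('X + I)) ^+ 2 *
   ((a + b) * (a + b - 1) * 'X^2 + s * (a + b)) * e); first by ring.
transitivity (('X - I) ^+ 2 * ('X + I) * I * (s - 1 + b - a) *
  (('X + I) * (b * u)) + ('X - I) * ('X + I) ^+ 2 * (s - 1 + a - b) *
  (('X - I) * (a * - I * v))); last by ring.
by rewrite d1 d2 up down; ring: iiP.
Qed.

(** The coefficientwise form of the equation
    ((H (E + F) + (E + F) H) / 2 - s (E - F)) f = 0.
    The conjunct on [f 1] is its component of degree 0. The equations
    are exchanged in pairs by f_j |-> f_(n - j). *)
Definition two_term n s f : Prop :=
  (s + 1 - n%:R) * f 1%N = 0 /\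
  forall j, j.+2%:R * (s + 3 - n%:R + 2 * j%:R) * f j.+2 =
            (n%:R - j%:R) * (s - 1 + n%:R - 2 * j%:R) * f j.

Lemma heun_op_pi_rep n s f : (forall j, (n < j)%N -> f j = 0) ->
  two_term n s f ->
  heun_op n s (pi_rep n (k0 R) (\poly_(j < n.+1) f j)) = 0.
Proof.
move=> f0 [f1 fS].
rewrite pi_rep_k0 -[_ *: \sum_(_ < _) _]addr0 heun_op_linear.
have -> : heun_op n s 0 = 0 :> {poly C}.
  by rewrite /heun_op !deriv0 !mul0r !scaler0 !(subr0, addr0).
rewrite addr0 heun_op_sum.
rewrite (eq_bigr (fun k : 'I_n.+1 => 'i%C *: (f k *:
  (((n%:R - k%:R) * (s - 1 + n%:R - 2 * k%:R)) *: cayley n k.+1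
           - (k%:R * (s - 1 - n%:R + 2 * k%:R)) *: cayley n k.-1)))); last first.
  move=> k _; rewrite coef_poly ltn_ord heun_op_cayley; last by rewrite -ltnS.
  by rewrite !scalerA mulrC.
rewrite -scaler_sumr (_ : \sum_(k < n.+1) _ = 0) ?scaler0 //.
pose u k : {poly C} := (f k * ((n%:R - k%:R) * (s - 1 + n%:R - 2 * k%:R)))
                         *: cayley n k.+1.
pose v k : {poly C} := (f k * (k%:R * (s - 1 - n%:R + 2 * k%:R)))
                         *: cayley n k.-1.
rewrite (eq_bigr (fun k : 'I_n.+1 => u k - v k)); last first.
  by move=> k _; rewrite scalerBr !(scalerA (f k)).
rewrite big_split /= sumrN; apply/eqP; rewrite subr_eq0; apply/eqP.
have uv k : u k = v k.+2.
  rewrite /u /v /=; congr (_ *: _); rewrite mulrC -fS -!natr1; ring.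
have v0 : v 0%N = 0 by rewrite /v mul0r mulr0 scale0r.
have v1 : v 1%N = 0.
  rewrite /v (_ : f 1%N * _ = 0) ?scale0r // -f1; ring.
have vn k : (n < k)%N -> v k = 0 by move=> /f0; rewrite /v => ->; rewrite mul0r scale0r.
rewrite (eq_bigr (fun k : 'I_n.+1 => v k.+2)) => [|k _]; last exact: uv.
transitivity (\sum_(k < n.+3) v k).
  rewrite [RHS]big_ord_recl [X in _ = _ + X]big_ord_recl /= v0 v1 !add0r.
  by apply: eq_bigr.
by rewrite 2!big_ord_recr /= !vn // !addr0.
Qed.

(** * The kernel of the Heun operator *)

(** The coefficientwise form of (E^2 - F^2 - s H) f = 0. *)
Definition three_term n s f : Prop :=
  (forall j, (j < 2)%N -> j.+1%:R * j.+2%:R * f j.+2 = s * (n%:R - 2 * j%:R) * f j) /\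
  (forall j, j.+3%:R * j.+4%:R * f j.+4 =
     s * (n%:R - 2 * j.+2%:R) * f j.+2 + (n%:R - j%:R) * (n%:R - j%:R - 1) * f j).

Lemma heun_op_coef n s q : heun_op n s q = 0 -> three_term n s (fun j => q`_j).
Proof.
move=> Hq; have H j : (heun_op n s q)`_j = 0 by rewrite Hq coef0.
split=> j.
  move=> lt_j2; have := H j.
  rewrite /heun_op !(coefN, coefD, coefZ, coefMXn, coefMX, coef_deriv).
  case: j lt_j2 => [|[|//]] _ /=.
    by move=> h; apply/eqP; rewrite -subr_eq0 -[X in _ == X]h; apply/eqP; ring.
  by move=> h; apply/eqP; rewrite -subr_eq0 -[X in _ == X]h; apply/eqP; ring.
have := H j.+2; rewrite /heun_op !(coefN, coefD, coefZ, coefMXn, coefMX, coef_deriv) /=.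
case: j => [|[|j]] /= h; apply/eqP; rewrite -subr_eq0 -[X in _ == X]h; apply/eqP;
  rewrite ?subSS ?subn0; ring.
Qed.

(** Both Heun functions solve the same equation in t; the bit e is the parity
    of the solution. *)
Definition heunS n s (e : bool) : nat -> C :=
  ps_shift e (ps_sq (Hl (- 1) (- ((n%:R - 2 * e%:R) * s / 4))
    (- ((n%:R - e%:R) / 2)) (- ((n%:R - 1 - e%:R) / 2)) ((1 + 2 * e%:R) / 2)
    ((1 - n%:R - s) / 2))).

Lemma heunSE n s : heunS n s false = uS n s /\ heunS n s true = vS n s.
Proof.
rewrite /heunS /uS /vS.
rewrite [nat_of_bool _]/= [nat_of_bool true]/= !mulr0 !mulr1 !subr0 addr0.
rewrite (_ : 1 + 2 = 3 :> C); last by ring.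
rewrite (_ : n%:R - 1 - 1 = n%:R - 2 :> C); last by ring.
split=> //; by apply/funext => k; rewrite /ps_shift subn0.
Qed.

(** The three-term recursion links indices of equal parity and is solvable for
    the highest one, so a nonzero polynomial solution of parity e has a nonzero
    coefficient of index e; after normalization it satisfies the recursion that
    characterizes the local Heun function. In particular the latter is then a
    polynomial. *)
Lemma heun_kernel n s (e : bool) q : three_term n s (fun j => q`_j) ->
  (forall j, odd j != e -> q`_j = 0) -> q != 0 ->
  q`_e != 0 /\ poly_of_ps ((q`_e)^-1 *: q) (heunS n s e).
Proof.
move=> [H0 HS] par q0.
have qe0 : q`_e != 0.
  apply: contraNneq q0 => qe0; apply/eqP/polyP => j; rewrite coef0.
  have [/par //|/negbNE/eqP oj] := boolP (odd j != e).
  rewrite -(odd_double_half j) oj addnC.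
  suff: q`_(j./2.*2 + e) = 0 /\ q`_(j./2.+1.*2 + e) = 0 by case.
  have cancel m (x : C) : m.+1%:R * m.+2%:R * x = 0 -> x = 0.
    by move=> /eqP; rewrite !mulf_eq0 !pnatr_eq0 => /eqP.
  elim: (j./2) => [|k [IH1 IH2]].
    split; first by [].
    by apply: (cancel e); rewrite (H0 e) ?qe0 ?mulr0 //; case: (e).
  split=> //; apply: (cancel (k.*2 + e).+2).
  rewrite doubleS !addSn in IH2.
  by rewrite !doubleS !addSn HS IH1 IH2 !mulr0 addr0.
split=> // j; rewrite coefZ /heunS /ps_shift /ps_sq.
set al := - ((n%:R - e%:R) / 2); set be := - ((n%:R - 1 - e%:R) / 2).
set ga := (1 + 2 * e%:R) / 2; set de := (1 - n%:R - s) / 2; set qq := - (_ * s / 4).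
have g0 k : ga != - k%:R.
  have -> : ga = (1 + 2 * e)%N%:R / 2 by rewrite /ga natrD natrM.
  rewrite -subr_eq0 opprK (_ : _ / 2 + _ = (1 + 2 * e + 2 * k)%N%:R / 2); last first.
    by field.
  by rewrite mulf_neq0 ?invr_eq0 ?pnatr_eq0.
have m1 : (-1 : C) != 0 by rewrite oppr_eq0 oner_eq0.
have [_ uniq] := @HlP R (-1) qq al be ga de m1 g0.
pose g k := (q`_e)^-1 * q`_(k.*2 + e).
(* This identity lets field treat both parities at once. *)
have ee : e%:R * e%:R = e%:R :> C by case: (e); rewrite ?mulr0 ?mulr1.
have Hg : is_local_heun (-1) qq al be ga de g.
  split; first by rewrite /g mulVf.
  apply/heun_equationE => eps [|k].
    have h : e.+1%:R * e.+2%:R * q`_e.+2 = s * (n%:R - 2 * e%:R) * q`_e.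
      by apply: H0; case: (e).
    rewrite /g /qq /ga -!natr1 in h *.
    transitivity (- (q`_e)^-1 / 4 * ((e%:R + 1) * (e%:R + 1 + 1) * q`_e.+2)).
      by rewrite /=; field: ee.
    by rewrite h /=; field.
  have h := HS (k.*2 + e).
  rewrite /g /eps /al /be /ga /de /qq !doubleS !addSn.
  rewrite -!natr1 natrD -muln2 natrM in h *.
  transitivity (- (q`_e)^-1 / 4 *
    ((k%:R * 2 + e%:R + 1 + 1 + 1) * (k%:R * 2 + e%:R + 1 + 1 + 1 + 1) *
      q`_(k * 2 + e).+4)).
    by field: ee.
  by rewrite h; field: ee.
rewrite -(uniq g Hg) /g.
have [lt_je|le_ej] := ltnP j e.
  by rewrite (par j) ?mulr0 //; move: lt_je; case: (e) => //; case: (j).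
have [od|ev] := boolP (odd (j - e)).
  rewrite (par j) ?mulr0 //; move: od; rewrite oddB // oddb.
  by case: (odd j); case: (e).
by rewrite even_halfK // subnK.
Qed.

(** * Reflection symmetry *)

Lemma coef_comp_polyNX q j : (q \Po (- 'X))`_j = (-1) ^+ j * q`_j.
Proof.
elim/poly_ind: q j => [|q c IH] j; first by rewrite comp_poly0 coef0 mulr0.
rewrite comp_poly_MXaddC mulrN coefD coefN coefMX coefC coefD coefMX coefC.
case: j => [|j] /=; first by rewrite oppr0 expr0 mul1r.
by rewrite IH !addr0 exprS mulN1r mulNr.
Qed.

(** The symmetry sign (-1)^t of the coefficients of f, their parity e and the
    sign (-1)^(n/2) from [cayley_reflect] multiply to the parity of the image of
    f, which is a nonzero element of the kernel of the Heun operator. *)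
Lemma sim_k0_heunS n s f (t e : bool) : ~~ odd n ->
  (forall j, (n < j)%N -> f j = 0) -> two_term n s f ->
  (exists2 j, (j <= n)%N & f j != 0) ->
  (forall j, (j <= n)%N -> f (n - j)%N = (-1) ^+ t * f j) ->
  (forall j, odd j != e -> f j = 0) ->
  sim_k0 n f (heunS n s (t (+) e (+) odd n./2)).
Proof.
move=> ev f0 rec [j0 le_j0 fj0] refl par.
set sg := t (+) e (+) odd n./2.
pose p := \poly_(j < n.+1) f j.
have pE : poly_of_ps p f.
  move=> j; rewrite coef_poly; case: ltnP => // /f0 ->//.
pose q := pi_rep n (k0 R) p; pose c : C := (((Num.sqrt 2)^-1)%:C) ^+ n.
have c0 : c != 0.
  by rewrite expf_neq0 // fmorph_eq0 invr_eq0 sqrtr_eq0 -ltNge ltr0n.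
have qE : q = c *: \sum_(k < n.+1) f k *: cayley n k.
  by rewrite /q pi_rep_k0; congr (_ *: _); apply: eq_bigr => k _; rewrite pE.
have q0 : q != 0.
  apply: contraNneq fj0; rewrite qE => /eqP; rewrite scaler_eq0 (negPf c0) /=.
  by move=> /eqP/cayley_free ->.
have qN : q \Po (- 'X) = (-1) ^+ sg *: q.
  rewrite qE comp_polyZ !scalerA mulrC -scalerA; congr (_ *: _).
  rewrite rmorph_sum scaler_sumr /= (reindex_inj rev_ord_inj) /=.
  apply: eq_bigr => k _; have le_kn : (k <= n)%N by rewrite -ltnS.
  rewrite comp_polyZ subSS cayley_reflect ?leq_subr // subKn //.
  rewrite !(scalerA _ _ (cayley _ _)).
  congr (_ *: _); rewrite refl //.
  have [/par ->|/negbNE/eqP ok] := boolP (odd k != e); first by rewrite !(mulr0, mul0r).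
  rewrite mulrAC -exprD -[in LHS]signr_odd; congr (_ ^+ nat_of_bool _ * _).
  by rewrite /sg !oddD oddB // ok (negPf ev) oddb addbA.
have qpar j : odd j != sg -> q`_j = 0.
  have := congr1 (fun p => p`_j) qN; rewrite coef_comp_polyNX coefZ -signr_odd.
  case: (odd j) (sg) => [] [] //= + _; rewrite ?expr0 ?expr1 ?mulN1r ?mul1r.
    by move=> /eqP; rewrite eq_sym -addr_eq0 -mulr2n mulrn_eq0 /= => /eqP.
  by move=> /eqP; rewrite -addr_eq0 -mulr2n mulrn_eq0 /= => /eqP.
have [qs0 qs] := heun_kernel (heun_op_coef (heun_op_pi_rep f0 rec)) qpar q0.
exists p, ((q`_sg)^-1 *: q); split=> //; first exact: size_poly.
  by apply: leq_trans (size_scale_leq _ _) _; apply: size_pi_rep_k0.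
by exists q`_sg; rewrite scalerA mulfV // scale1r.
Qed.

(** The recursion at m and its mirror image at n - m express f_(m - 1) through
    f_(m + 1) and f_(n - m + 1) through f_(n - m - 1) with the same
    coefficients. So the symmetry propagates outwards from the middle as long as
    the factor in front of f_(m - 1) does not vanish. *)
Lemma two_term_palindromic n s f (e : bool) : ~~ odd n ->
  two_term n s f -> (forall j, odd j != e -> f j = 0) ->
  (forall m, (0 < m <= n./2)%N -> odd m != e -> s + 1 + n%:R - 2 * m%:R != 0) ->
  forall j, (j <= n)%N -> f (n - j)%N = f j.
Proof.
move=> ev [_ rec] par nz; pose h := n./2; have nh : n = (h + h)%N by lia.
have step k : (k < h)%N -> ((0 < k)%N -> f (h + k).-1 = f (h - k).+1) ->
    f (h + k).+1 = f (h - k).-1.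
  move=> lt_kh IH; have [od|/negbNE/eqP od] := boolP (odd (h - k) != e); last first.
    by rewrite !par //; lia.
  have [m mE] : exists m, h = (m + k).+1 by exists (h - k).-1; lia.
  have b0 : s + 1 + n%:R - 2 * m.+1%:R != 0.
    by apply: nz; [lia | rewrite (_ : m.+1 = (h - k)%N) //; lia].
  have rlo := rec m; have rhi := rec (m + k + k)%N.
  have e1 : (h - k).-1 = m by lia.
  have e2 : (h - k).+1 = m.+2 by lia.
  have e3 : (h + k).-1 = (m + k + k)%N by lia.
  have e4 : (h + k).+1 = (m + k + k).+2 by lia.
  rewrite e1 e2 e3 e4 in IH *.
  have nE : n%:R = 2 * (m%:R + k%:R + 1) :> C by rewrite nh mE -natr1 !natrD; ring.
  have c0 : (m + k + k).+2%:R != 0 :> C by rewrite pnatr_eq0.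
  apply: (mulfI (mulf_neq0 c0 b0)).
  (* At the centre m + 1 = n / 2 the recursion is its own mirror image and
     already compares the two neighbours of the middle index. *)
  have [k0|k0] := posnP k.
    rewrite k0 !addn0 nE k0 in rlo *; apply: etrans (etrans rlo _).
      by rewrite -!natr1; ring.
    by rewrite -!natr1; ring.
  rewrite (IH k0) nE !natrD in rhi; rewrite nE in rlo *.
  apply: etrans (etrans rhi _); first by rewrite -!natr1 !natrD; ring.
  rewrite -!natr1 in rlo *; apply: etrans (etrans rlo _); ring.
have P k : (k <= h)%N -> f (h + k)%N = f (h - k)%N /\
                         ((0 < k)%N -> f (h + k).-1 = f (h - k).+1).
  elim: k => [|k IH] lt_kh; first by rewrite addn0 subn0.
  have [IH1 IH2] := IH (ltnW lt_kh).
  rewrite addnS subnS; split; first exact: step.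
  by move=> _; rewrite /= IH1 prednK // subn_gt0.
move=> j le_jn; have [le_jh|lt_hj] := leqP j h.
  have -> : j = (h - (h - j))%N by lia.
  by rewrite -(P (h - j)%N _).1; [congr f; lia | lia].
have -> : j = (h + (j - h))%N by lia.
by rewrite (P (j - h)%N _).1; [congr f; lia | lia].
Qed.

End Cayley.

(** * The hypergeometric polynomials *)

Section Hyper.
Set Implicit Arguments.
Unset Strict Implicit.
Variable R : realType.
Local Notation C := R[i].
Implicit Types (n k : nat) (s a b c : C) (f : nat -> C).

Lemma sfactS a k : sfact a k.+1 = sfact a k * (a + k%:R).
Proof. by rewrite /sfact big_ord_recr. Qed.

(** The hypothesis covers the series truncated by a vanishing denominator: the
    recursion survives if the numerator vanishes no later. *)
Lemma hypFS a b c k :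
  (sfact c k.+1 = 0 -> sfact a k.+1 * sfact b k.+1 = 0) ->
  k.+1%:R * (c + k%:R) * hypF a b c k.+1 = (a + k%:R) * (b + k%:R) * hypF a b c k.
Proof.
move=> H; rewrite /hypF.
have kf0 : k`!%:R != 0 :> C by rewrite pnatr_eq0 -lt0n fact_gt0.
have k0 : k%:R + 1 != 0 :> C by rewrite natr1 pnatr_eq0.
have [ck|ck] := eqVneq (sfact c k.+1) 0.
  rewrite ck mul0r invr0 !mulr0; move: (H ck); rewrite !sfactS => h.
  transitivity (sfact a k * (a + k%:R) * (sfact b k * (b + k%:R)) / (sfact c k * k`!%:R)).
    by rewrite h mul0r.
  ring.
move: ck; rewrite !sfactS mulf_eq0 negb_or => /andP[c0 ck0].
by rewrite factS natrM -natr1; field; rewrite c0 kf0 k0 ck0.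
Qed.

Lemma hypF0 a b c : hypF a b c 0 = 1.
Proof. by rewrite /hypF /sfact !big_ord0 fact0 !mulr1 divr1. Qed.

Lemma sfact_eq0P c k : sfact c k = 0 -> exists2 j, (j < k)%N & c = - j%:R.
Proof.
move=> /eqP/prodf_eq0 [[j lt_jk] _ /= /eqP cj].
by exists j => //; apply/eqP; rewrite -subr_eq0 opprK cj.
Qed.

Lemma aS_odd n s j : odd j -> aS n s j = 0.
Proof. by rewrite /aS /ps_sq => ->. Qed.

Lemma aS_even n s k : aS n s k.*2 =
  hypF (- (n%:R / 2)) (- ((n%:R + s - 1) / 4)) ((3 - n%:R + s) / 4) k.
Proof. by rewrite /aS /ps_sq odd_double doubleK. Qed.

Lemma aS0 n s : aS n s 0 = 1.
Proof. by rewrite -[0%N]double0 aS_even hypF0. Qed.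

Lemma natr_half n : ~~ odd n -> n%:R / 2 = n./2%:R :> C.
Proof.
by move=> ev; rewrite -[X in X%:R / _](even_halfK ev) -muln2 natrM mulfK ?pnatr_eq0.
Qed.

Lemma aS_gt n s j : ~~ odd n -> (n < j)%N -> aS n s j = 0.
Proof.
move=> ev lt_nj; have [/aS_odd -> //|evj] := boolP (odd j).
rewrite -(even_halfK evj) aS_even /hypF natr_half // sfact_eq0 ?mul0r //; lia.
Qed.

Lemma aS_two_term n s :
  (forall k, sfact ((3 - n%:R + s) / 4) k.+1 = 0 ->
     sfact (- (n%:R / 2)) k.+1 * sfact (- ((n%:R + s - 1) / 4)) k.+1 = 0) ->
  two_term n s (aS n s).
Proof.
move=> H; split=> [|j]; first by rewrite aS_odd ?mulr0.
have [oj|evj] := boolP (odd j); first by rewrite !aS_odd ?mulr0 //= negbK.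
rewrite -(even_halfK evj) -doubleS !aS_even; set k := j./2.
have := hypFS (H k).
set u := hypF _ _ _ k; set v := hypF _ _ _ k.+1 => h.
transitivity (8 * (k.+1%:R * ((3 - n%:R + s) / 4 + k%:R) * v)).
  by rewrite -!muln2 !natrM -!natr1; field.
by rewrite h -!muln2 !natrM; field.
Qed.

Lemma bSE n s r : s = n%:R + 1 - 2 * r%:R ->
  bS n s = ps_shift r (ps_sq (hypF (- ((n%:R - r%:R) / 2)) (- (n%:R / 2 - r%:R))
                                 ((r%:R + 2) / 2))).
Proof.
move=> ->; rewrite /bS (_ : (1 + n%:R - _) / 2 = r%:R); last by field.
by rewrite natpart_nat; congr (ps_shift r (ps_sq (hypF _ _ _))); field.
Qed.

(** The exponent (1 + n - s) / 2 is r when s = n + 1 - 2 r. The two-term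
    recursion then breaks at r, where the
    coefficient in front of f_r vanishes, and by symmetry at n - r. *)
Section Shifted.
Variables (n : nat) (s : C) (r : nat).
Hypothesis sE : s = n%:R + 1 - 2 * r%:R.

Lemma bS_lt j : (j < r)%N -> bS n s j = 0.
Proof. by rewrite (bSE sE) /ps_shift => ->. Qed.

Lemma bS_odd j : odd j != odd r -> bS n s j = 0.
Proof.
move=> par; rewrite (bSE sE) /ps_shift; case: ltnP => // le_rj.
by rewrite /ps_sq oddB // -negb_eqb par.
Qed.

Lemma bS_even k : bS n s (r + k.*2) =
  hypF (- ((n%:R - r%:R) / 2)) (- (n%:R / 2 - r%:R)) ((r%:R + 2) / 2) k.
Proof.
by rewrite (bSE sE) /ps_shift ltnNge leq_addr /= addKn /ps_sq odd_double doubleK.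
Qed.

Lemma bSr : bS n s r = 1.
Proof. by have := bS_even 0; rewrite addn0 hypF0. Qed.

Lemma bS_two_term : (0 < r)%N -> two_term n s (bS n s).
Proof.
move=> r0; split.
  have [r1|r1] := eqVneq r 1%N; first by rewrite [X in X + 1]sE r1; ring.
  by rewrite bS_lt ?mulr0 //; lia.
move=> j; have [par|/negbNE/eqP par] := boolP (odd j != odd r).
  by rewrite !bS_odd ?mulr0 //= negbK.
have [lt_jr|le_rj] := ltnP j r.
  have [jr|jr] : j.+2 = r \/ (j.+2 < r)%N by lia.
    by rewrite (bS_lt lt_jr) jr bSr [X in X + 3]sE -jr -!natr1; ring.
  by rewrite !bS_lt ?mulr0.
have [k ->] : exists k, j = (r + k.*2)%N by exists (j - r)./2; lia.
rewrite -!addnS -doubleS !bS_even.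
have := @hypFS (- ((n%:R - r%:R) / 2)) (- (n%:R / 2 - r%:R)) ((r%:R + 2) / 2) k.
set u := hypF _ _ _ k; set v := hypF _ _ _ k.+1 => h.
have {}h : k.+1%:R * ((r%:R + 2) / 2 + k%:R) * v
         = (- ((n%:R - r%:R) / 2) + k%:R) * (- (n%:R / 2 - r%:R) + k%:R) * u.
  apply: h => /sfact_eq0P [i _] /eqP; rewrite -subr_eq0 opprK.
  rewrite (_ : (r%:R + 2) / 2 + _ = (r + 2 + 2 * i)%N%:R / 2); last by field.
  by rewrite mulf_eq0 invr_eq0 !pnatr_eq0 addn2.
transitivity (8 * (k.+1%:R * ((r%:R + 2) / 2 + k%:R) * v)).
  by rewrite [X in X + 3]sE natrD -!muln2 !natrM -!natr1; field.
by rewrite h [X in X - 1]sE natrD -!muln2 !natrM; field.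
Qed.

(** If r <= n / 2 the second parameter is the integer - (n / 2 - r), otherwise
    the series ends because the first one is - (n - r) / 2. *)
Lemma bS_gt j : ~~ odd n -> (n < j)%N -> (r <= n./2)%N || ~~ odd r && (r <= n)%N ->
  bS n s j = 0.
Proof.
move=> ev lt_nj hr; have [lt_jr|le_rj] := ltnP j r; first exact: bS_lt.
have [/bS_odd//|/negbNE/eqP par] := boolP (odd j != odd r).
have [k jE] : exists k, j = (r + k.*2)%N by exists (j - r)./2; lia.
rewrite jE bS_even /hypF.
case/orP: hr => [le_rh|/andP[evr le_rn]].
  rewrite natr_half // -(natrB _ le_rh) (@sfact_eq0 R (n./2 - r)%N k).
    by rewrite mulr0 mul0r.
  by lia.
rewrite -(natrB _ le_rn) (@natr_half (n - r)); last by rewrite oddB // (negPf evr) addbF.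
by rewrite (@sfact_eq0 R (n - r)./2%N k) ?mul0r //; lia.
Qed.

End Shifted.

(** The excluded values of s are those where the recursion for even indices
    breaks at some r with 0 < r <= n. *)
Lemma sim_k0_aS n s : ~~ odd n ->
  (forall r, (0 < r <= n)%N -> ~~ odd r -> s <> n%:R + 1 - 2 * r%:R) ->
  sim_k0 n (aS n s) (heunS n s (odd n./2)).
Proof.
move=> ev sN.
have rec : two_term n s (aS n s).
  apply: aS_two_term => k /sfact_eq0P [j lt_jk cj].
  rewrite natr_half // [X in X * _]sfact_eq0 ?mul0r //.
  (* A zero j of the denominator with j < n / 2 would make s the excluded value
     with r = 2 j + 2; beyond n / 2 the first parameter has ended the series. *)
  rewrite ltnNge; apply/negP => lt_kh; apply: (sN j.+1.*2); [lia | lia |].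
  rewrite (_ : s = 4 * ((3 - n%:R + s) / 4) - 3 + n%:R); last by field.
  by rewrite cj -muln2 natrM -natr1; ring.
have par j : odd j != false -> aS n s j = 0 by rewrite eqbF_neg negbK; exact: aS_odd.
rewrite -[odd n./2]/(false (+) false (+) odd n./2).
apply: sim_k0_heunS => //.
- by move=> j; exact: aS_gt.
- by exists 0%N; rewrite // aS0 oner_neq0.
move=> j le_jn; rewrite expr0 mul1r.
apply: (two_term_palindromic ev rec par) => // m lt_m om.
(* A vanishing factor at m is the mirror image of a break at r = n + 1 - m. *)
apply/eqP => sm; apply: (sN (n + 1 - m)%N); [lia | lia |].
rewrite natrB; last by lia.
by apply/eqP; rewrite -subr_eq0 -[X in _ == X]sm; apply/eqP; rewrite natrD; ring.
Qed.

(** For r <= n / 2 the solution starting at r ends at n - r; it contains the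
    middle index, and the downward recursion breaks only at n - r, which is not
    below the middle. *)
Lemma sim_k0_bS n s r : ~~ odd n -> (0 < r <= n./2)%N ->
  s = n%:R + 1 - 2 * r%:R ->
  sim_k0 n (bS n s) (heunS n s (odd r (+) odd n./2)).
Proof.
move=> ev /andP[r0 le_rh] sE.
have rec := bS_two_term sE r0; have par := bS_odd sE.
rewrite -[odd r]/(false (+) odd r).
apply: sim_k0_heunS => //.
- by move=> j lt_nj; apply: (bS_gt sE) => //; rewrite le_rh.
- by exists r; [lia | rewrite (bSr sE) oner_neq0].
move=> j le_jn; rewrite expr0 mul1r.
apply: (two_term_palindromic ev rec par) => // m lt_m om; rewrite sE.
rewrite (_ : _ - _ = (2 * (n + 1 - r - m))%N%:R); first by rewrite pnatr_eq0; lia.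
by rewrite natrM !natrB ?natrD; [ring | lia | lia].
Qed.

End Hyper.

(** * The values of s with two solutions of the same parity *)

(** When r is even and n / 2 < r <= n, the solution [aS] ends at n - r, before
    the solution [bS] starts at r. They are mirror images of each other up to
    the factor [Ccst], so that their sum and difference with this factor are
    symmetric and antisymmetric. *)
Section Resonance.
Set Implicit Arguments.
Unset Strict Implicit.
Variable R : realType.
Local Notation C := R[i].

Variables (n r : nat) (s : C).
Hypotheses (ev : ~~ odd n) (evr : ~~ odd r) (lt_hr : (n./2 < r)%N) (le_rn : (r <= n)%N).
Hypothesis sE : s = n%:R + 1 - 2 * r%:R.

Let r0 : (0 < r)%N. Proof. lia. Qed.
Let evnr : ~~ odd (n - r). Proof. by rewrite oddB // (negPf evr) addbF. Qed.

Lemma aS_second_param : (n%:R + s - 1) / 4 = (n - r)./2%:R.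
Proof.
by rewrite -natr_half // natrB // sE; field.
Qed.

Lemma aS_third_param : (3 - n%:R + s) / 4 = - (r./2.-1)%:R.
Proof.
rewrite -subn1 natrB; last by lia.
by rewrite -natr_half // sE; field.
Qed.

Lemma aS_minus_gt j : (n - r < j)%N -> aS n s j = 0.
Proof.
move=> lt_j; have [/aS_odd -> //|evj] := boolP (odd j).
rewrite -(even_halfK evj) aS_even aS_second_param /hypF.
by rewrite (@sfact_eq0 R (n - r)./2%N j./2) ?mulr0 ?mul0r //; lia.
Qed.

Lemma aS_minus_two_term : two_term n s (aS n s).
Proof.
apply: aS_two_term => k; rewrite aS_third_param aS_second_param.
have [lt_kM|le_Mk] := ltnP k (r./2.-1).
  by move=> /eqP; rewrite (negPf (@sfact_neq0 R _ _ lt_kM)).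
by move=> _; rewrite (@sfact_eq0 R (n - r)./2%N k.+1) ?mulr0 //; lia.
Qed.

(** The last coefficient of [aS]. For s = -1 the second and third parameters
    coincide and the corresponding shifted factorials cancel, which is why the
    two formulas in [Ccst] agree. *)
Lemma Ccst_top : Ccst n s = aS n s (n - r).
Proof.
rewrite -[in RHS](even_halfK evnr) aS_even /Ccst.
rewrite aS_second_param aS_third_param natpart_nat.
set N := (n - r)./2; rewrite /hypF.
case: ifP => [/andP[/eqP n4 /eqP s1]|_]; last first.
  by rewrite mul1r invfM mulrA.
have rh : r = n./2.+1.
  have : (2 * r)%N%:R = (n + 2)%N%:R :> C.
    apply/eqP; rewrite -subr_eq0 natrM natrD; apply/eqP.
    rewrite (_ : 2 * _ = n%:R + 1 - s); last by rewrite sE; ring.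
    by rewrite s1; ring.
  by move=> /eqP; rewrite eqr_nat => /eqP; lia.
have -> : (n %/ 4)%N = N by rewrite /N; lia.
have -> : (r./2.-1)%N = N by rewrite /N; lia.
have N0 := @sfact_neq0 R N N (leqnn N).
have f0 : N`!%:R != 0 :> C by rewrite pnatr_eq0 -lt0n fact_gt0.
by field; rewrite N0 f0.
Qed.

(** Both sides satisfy the same recursion upwards from r, whose factor in front
    of the next term no longer vanishes, and they agree at r. *)
Lemma bS_reflects_aS j : (j <= n)%N -> Ccst n s * bS n s j = aS n s (n - j).
Proof.
move=> le_jn; have [lt_jr|le_rj] := ltnP j r.
  by rewrite (bS_lt sE lt_jr) mulr0 aS_minus_gt //; lia.
have [oj|evj] := boolP (odd j).
  rewrite (bS_odd sE) ?(negPf evr) ?oj // mulr0 aS_odd // oddB // (negPf ev) oj //.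
have [k jE] : exists k, j = (r + k.*2)%N by exists (j - r)./2; lia.
elim: k j jE {le_rj evj} le_jn => [|k IH] j jE le_jn.
  by rewrite jE addn0 (bSr sE) mulr1 Ccst_top.
have jE2 : j = (r + k.*2).+2 by rewrite jE doubleS !addnS.
set i := (r + k.*2)%N in jE2; have {}IH := IH i erefl.
have [_ rb] := bS_two_term sE r0; have [_ ra] := aS_minus_two_term.
have := rb i; have := ra (n - j)%N.
rewrite {}jE2 in le_jn *.
have <- : (n - i = (n - i.+2).+2)%N by lia.
rewrite -IH; last by lia.
have [d dE] : exists d, n = (d + i.+2)%N by exists (n - i.+2)%N; lia.
have -> : (n - i.+2 = d)%N by lia.
have nd : n%:R = d%:R + i%:R + 2 :> C by rewrite dE -addn2 !natrD; ring.
have ir : i%:R = r%:R + 2 * k%:R :> C by rewrite /i natrD -muln2 natrM; ring.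
have i2 : i.+2%:R = r%:R + 2 * k%:R + 2 :> C by rewrite -addn2 natrD ir.
have d2 : (n - i)%N%:R = d%:R + 2 :> C.
  by rewrite (_ : n - i = d + 2)%N ?natrD //; lia.
have c0 : i.+2%:R * (4 * k.+1%:R) != 0 :> C by rewrite !mulf_neq0 ?pnatr_eq0.
move=> ea eb; apply: (mulfI c0).
have {}ea : (d%:R + 2) * (4 - 2 * r%:R + 2 * d%:R) * (Ccst n s * bS n s i) =
            i.+2%:R * (4 * k.+1%:R) * aS n s d.
  apply: etrans (etrans ea _); first by rewrite sE nd d2; ring.
  by rewrite sE nd i2 ir -natr1; ring.
have {}eb : i.+2%:R * (4 * k.+1%:R) * bS n s i.+2 =
            (d%:R + 2) * (4 - 2 * r%:R + 2 * d%:R) * bS n s i.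
  apply: etrans (etrans eb _); first by rewrite sE nd i2 ir -natr1; ring.
  by rewrite sE nd; ring.
by rewrite mulrCA eb mulrCA ea.
Qed.

Lemma sim_k0_aS_pm_bS (t : bool) :
  sim_k0 n (fun k => aS n s k + (-1) ^+ t * (Ccst n s * bS n s k))
           (heunS n s (t (+) odd n./2)).
Proof.
rewrite -[t in heunS _ _ (t (+) _)]addbF.
have [a1 aS_] := aS_minus_two_term; have [b1 bS_] := bS_two_term sE r0.
apply: sim_k0_heunS => //.
- move=> j lt_nj; rewrite aS_gt // (bS_gt sE) // ?mulr0 ?addr0 //.
  by rewrite evr le_rn orbT.
- split=> [|j].
    transitivity ((s + 1 - n%:R) * aS n s 1 +
      (-1) ^+ t * Ccst n s * ((s + 1 - n%:R) * bS n s 1)); first by ring.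
    by rewrite a1 b1; ring.
  transitivity (j.+2%:R * (s + 3 - n%:R + 2 * j%:R) * aS n s j.+2 +
    (-1) ^+ t * Ccst n s * (j.+2%:R * (s + 3 - n%:R + 2 * j%:R) * bS n s j.+2)).
    by ring.
  by rewrite aS_ bS_; ring.
- by exists 0%N; rewrite // aS0 (bS_lt sE) // !mulr0 addr0 oner_neq0.
- move=> j le_jn; rewrite bS_reflects_aS ?leq_subr // subKn //.
  rewrite bS_reflects_aS // mulrDr mulrA -signr_addb addbb mul1r addrC //.
- move=> j; rewrite eqbF_neg negbK => oj.
  by rewrite aS_odd // (bS_odd sE) ?mulr0 ?addr0 // (negPf evr) oj.
Qed.

End Resonance.

Lemma sim_k0_cplusS (R : realType) n r (s : R[i]) : ~~ odd n -> ~~ odd r ->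
  (n./2 < r)%N -> (r <= n)%N -> s = n%:R + 1 - 2 * r%:R ->
  sim_k0 n (cplusS n s) (heunS n s (odd n./2)).
Proof.
move=> ev evr lt_hr le_rn sE.
have := sim_k0_aS_pm_bS ev evr lt_hr le_rn sE false.
congr (sim_k0 n _ _); apply/funext => k.
by rewrite /cplusS expr0 mul1r.
Qed.

Lemma sim_k0_cminusS (R : realType) n r (s : R[i]) : ~~ odd n -> ~~ odd r ->
  (n./2 < r)%N -> (r <= n)%N -> s = n%:R + 1 - 2 * r%:R ->
  sim_k0 n (cminusS n s) (heunS n s (~~ odd n./2)).
Proof.
move=> ev evr lt_hr le_rn sE.
have := sim_k0_aS_pm_bS ev evr lt_hr le_rn sE true.
congr (sim_k0 n _ _); apply/funext => k.
by rewrite /cminusS expr1 mulN1r.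
Qed.

(** * The theorem *)

Theorem lemma6p3 (R : realType) (n : nat) (hn : ~~ odd n) :
  ((n %% 4 = 0)%N ->
    (forall s : R[i], ~ (I0minus n s \/ J0 n s) -> sim_k0 n (aS n s) (uS n s)) /\
    (forall s : R[i], J0 n s -> sim_k0 n (bS n s) (uS n s)) /\
    (forall s : R[i], I0minus n s -> sim_k0 n (cplusS n s) (uS n s)) /\
    (forall s : R[i], I0plus n s -> sim_k0 n (bS n s) (vS n s)) /\
    (forall s : R[i], I0minus n s -> sim_k0 n (cminusS n s) (vS n s)))
  /\
  ((n %% 4 = 2)%N ->
    (forall s : R[i], ~ (I2minus n s \/ J2 n s) -> sim_k0 n (aS n s) (vS n s)) /\
    (forall s : R[i], J2 n s -> sim_k0 n (bS n s) (vS n s)) /\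
    (forall s : R[i], I2minus n s -> sim_k0 n (cplusS n s) (vS n s)) /\
    (forall s : R[i], I2plus n s -> sim_k0 n (bS n s) (uS n s)) /\
    (forall s : R[i], I2minus n s -> sim_k0 n (cminusS n s) (uS n s))).
Proof.
have uE s := (heunSE n s).1 : _ = uS n s :> (nat -> R[i]).
have vE s := (heunSE n s).2 : _ = vS n s :> (nat -> R[i]).
have posE m r : (m + 2 * r = n + 1)%N -> m%:R = n%:R + 1 - 2 * r%:R :> R[i].
  by move=> e; rewrite natr1 -addn1 -e natrD natrM; ring.
have negE m r : (2 * r = m + n + 1)%N -> - m%:R = n%:R + 1 - 2 * r%:R :> R[i].
  by move=> e; rewrite -natrM e !natrD; ring.
(* All the exceptional s are n + 1 - 2 r: the sets J consist of the even
   r <= n / 2, the sets I^+ of the odd ones, the sets I^- of the even r > n / 2. *)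
split=> n4.
  have hE : odd n./2 = false by lia.
  have bE (s : R[i]) r : (0 < r <= n./2)%N -> s = n%:R + 1 - 2 * r%:R ->
      sim_k0 n (bS n s) (heunS n s (odd r)).
    by move=> hr sE; have := sim_k0_bS hn hr sE; rewrite hE addbF.
  split; [|split; [|split; [|split]]] => s.
  - move=> sN; rewrite -uE -hE; apply: sim_k0_aS => // r hr evr sE; apply: sN.
    have [le_rh|lt_hr] := leqP r n./2; [right|left].
      exists (n %/ 4 - r./2)%N; first lia.
      by rewrite sE; apply/esym/posE; lia.
    exists (r./2 - n %/ 4 - 1)%N; first lia.
    by rewrite sE; apply/esym/negE; lia.
  - move=> [j lt_j ->]; rewrite -uE.
    have -> : false = odd (n./2 - 2 * j) by lia.
    by apply: bE; [lia | apply: posE; lia].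
  - move=> [j lt_j ->]; rewrite -uE -hE.
    by apply: (@sim_k0_cplusS _ _ (n./2 + 2 + 2 * j)%N) => //;
      [lia | lia | lia | apply: negE; lia].
  - move=> [j lt_j ->]; rewrite -vE.
    have -> : true = odd (n./2 - 1 - 2 * j) by lia.
    by apply: bE; [lia | apply: posE; lia].
  - move=> [j lt_j ->]; rewrite -vE -[true]/(~~ false) -hE.
    by apply: (@sim_k0_cminusS _ _ (n./2 + 2 + 2 * j)%N) => //;
      [lia | lia | lia | apply: negE; lia].
have hE : odd n./2 = true by lia.
have bE (s : R[i]) r : (0 < r <= n./2)%N -> s = n%:R + 1 - 2 * r%:R ->
    sim_k0 n (bS n s) (heunS n s (~~ odd r)).
  by move=> hr sE; have := sim_k0_bS hn hr sE; rewrite hE addbT.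
split; [|split; [|split; [|split]]] => s.
- move=> sN; rewrite -vE -hE; apply: sim_k0_aS => // r hr evr sE; apply: sN.
  have [le_rh|lt_hr] := leqP r n./2; [right|left].
    exists (n %/ 4 - r./2)%N; first lia.
    by rewrite sE; apply/esym/posE; lia.
  exists (r./2 - n %/ 4 - 1)%N; first lia.
  by rewrite sE; apply/esym/negE; lia.
- move=> [j lt_j ->]; rewrite -vE.
  have -> : true = ~~ odd (n./2 - 1 - 2 * j) by lia.
  by apply: bE; [lia | apply: posE; lia].
- move=> [j lt_j ->]; rewrite -vE -hE.
  by apply: (@sim_k0_cplusS _ _ (n./2 + 1 + 2 * j)%N) => //;
    [lia | lia | lia | apply: negE; lia].
- move=> [j lt_j ->]; rewrite -uE.
  have -> : false = ~~ odd (n./2 - 2 * j) by lia.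
  by apply: bE; [lia | apply: posE; lia].
- move=> [j lt_j ->]; rewrite -uE -[false]/(~~ true) -hE.
  by apply: (@sim_k0_cminusS _ _ (n./2 + 1 + 2 * j)%N) => //;
    [lia | lia | lia | apply: negE; lia].
Qed.
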